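(* Fix $\mu\ge 1$, $0<\varepsilon<1$, $\tau\ge 0$, $\sigma>0$, and consider configurations $A=(a^{(1)},\dots,a^{(\mu)})\in(\mathbb R^2)^\mu$. For either base indicator $\mathcal I\in\{\mathrm{HV},\ \mathrm{Mag}\circ D\}$, the map $A\mapsto J^{\mathcal I}_{\varepsilon,\tau}(A)$ is smooth on every region of configuration space on which (i) the membership of every point in every nondomination layer is fixed, (ii) the staircase combinatorics defining $\mathrm{HV}(A^{(\ell)})$ are fixed for each layer $\ell$, and (iii) in the magnitude case $\mathcal I=\mathrm{Mag}\circ D$, the points (indices) realizing the projected extents $X(A^{(\ell)})$ and $Y(A^{(\ell)})$ are fixed for each layer $\ell$.
   Context: Maximization convention: $y\in\mathbb R^2$ strictly dominates $z\in\mathbb R^2$ if $y_i\ge z_i$ for $i=1,2$ and $y\ne z$. The nondomination layers $A^{(1)},\dots,A^{(L)}$ of a labelled configuration $A$ are obtained by peeling: $A^{(1)}$ consists of the points (indices) not strictly dominated by any other point of $A$; $A^{(2)}$ is the analogous set after removing $A^{(1)}$; and so on until all points are exhausted. Membership is fixed if the index set of each layer is constant. For a finite set (or labelled family) $B$ of points of $\mathbb R^2$: $D(B):=\bigcup_{b\in B}[0,b_1]\times[0,b_2]$ is the origin-anchored dominated set (boxes of negative side length are omitted), $\mathrm{HV}(B):=\operatorname{area}(D(B))$ is the anchored hypervolume, $X(B):=\max_{b\in B}b_1$, $Y(B):=\max_{b\in B}b_2$, and $$\mathrm{Mag}(D(B)):=1+\frac{X(B)+Y(B)}{2}+\frac{\mathrm{HV}(B)}{4}.$$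 The layered scalar surrogate with repulsion is $$J^{\mathcal I}_{\varepsilon,\tau}(A):=\sum_{\ell=1}^{L}\varepsilon^{\ell-1}\mathcal I(A^{(\ell)})-\tau R_\sigma(A),\qquad R_\sigma(A):=\sum_{1\le i<j\le\mu}\exp\!\Bigl(-\frac{\|a^{(i)}-a^{(j)}\|_2^2}{\sigma^2}\Bigr).$$ Staircase combinatorics of a layer: the set of indices of the layer whose boxes are present (active) in the union $D$, together with the order (including ties) of these points by first coordinate along the staircase boundary of $D$. ''Smooth'' means $C^\infty$; on a region that is not open it means locally the restriction of a $C^\infty$ function. *)

(* Defs.v *)
From HB Require Import structures.
From mathcomp Require Import all_boot all_order all_algebra.
From mathcomp Require Import all_classical all_reals all_analysis.

Set Implicit Arguments.
Unset Strict Implicit.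
Unset Printing Implicit Defensive.

Import Order.TTheory GRing.Theory Num.Theory.
Import numFieldNormedType.Exports.

Local Open Scope ring_scope.

Section Smoothness.
Variables (R : realType) (V : normedModType R).

(* Intended for U open and V finite dimensional, where it is the usual notion:
   all directional (hence all partial) derivatives up to order n exist and are
   continuous on U. *)
Fixpoint Ck (n : nat) (U : set V) (f : V -> R) : Prop :=
  if n is n'.+1 then
    (forall x, U x -> differentiable f x) /\ (forall v, Ck n' U ('D_v f))
  else forall x, U x -> {for x, continuous f}.

Definition Cinfty (U : set V) (f : V -> R) : Prop := forall n, Ck n U f.

(* S is arbitrary: f need only coincide on S, near each point of S, with a
   function that is C^oo on an open set.  For open S this is the usual C^oo. *)
Definition smooth_on (S : set V) (f : V -> R) : Prop :=
  forall x, S x -> exists (U : set V) (g : V -> R),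
    [/\ open U, U x, Cinfty U g & forall y, S y -> U y -> g y = f y].

End Smoothness.

Section Surrogate.
Variables (R : realType) (mu : nat).

(* A configuration is a mu x 2 matrix whose i-th row is the i-th point; a
   labelled subfamily of it is a set of row indices. *)
Notation config := 'M[R]_(mu, 2).
Implicit Types (A : config) (B : {set 'I_mu}) (S : set config).

Definition strictly_dominates (y z : 'rV[R]_2) : bool :=
  [forall k, z 0 k <= y 0 k] && (y != z).

Definition nondominated A B : {set 'I_mu} :=
  [set i in B | ~~ [exists j in B, strictly_dominates (row j A) (row i A)]]%SET.

Fixpoint peel A (fuel : nat) B : seq {set 'I_mu} :=
  if fuel is n.+1 then
    if B == finset.set0 then [::]
    else nondominated A B :: peel A n (B :\: nondominated A B)
  else [::].

(* Each step removes at least one index, so mu steps exhaust the family (see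
   layers_cover).  Layers are numbered from 0: layer A l is A^(l+1). *)
Definition layers A : seq {set 'I_mu} := peel A mu finset.setT.
Definition nlayers A : nat := size (layers A).
Definition layer A (l : nat) : {set 'I_mu} := nth finset.set0 (layers A) l.

(* [0, b] is empty when b < 0, so boxes of negative side length drop out. *)
Definition dominated_region A B : set (R * R) :=
  (\bigcup_(i in [set` B]) (`[0, A i 0] `*` `[0, A i 1]))%classic.

Definition HV A B : R :=
  fine ((lebesgue_measure \x lebesgue_measure)%E (dominated_region A B)).

(* Maximum of the k-th coordinate over B (used for nonempty B only). *)
Definition extent (k : 'I_2) A B : R :=
  fine (\big[maxe/-oo%E]_(i in B) (A i k)%:E).

Definition MagD A B : R :=
  1 + (extent 0 A B + extent 1 A B) / 2 + HV A B / 4.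

Definition enorm (v : 'rV[R]_2) : R := Num.sqrt (\sum_k v 0 k ^+ 2).

Definition repulsion (sigma : R) A : R :=
  \sum_(i < mu) \sum_(j < mu | (i < j)%N)
    expR (- (enorm (row i A - row j A) ^+ 2 / sigma ^+ 2)).

Definition surrogate (I : config -> {set 'I_mu} -> R) (eps tau sigma : R) A : R :=
  \sum_(0 <= l < nlayers A) eps ^+ l * I A (layer A l) - tau * repulsion sigma A.

Definition fixed_membership S : Prop :=
  forall A A', S A -> S A' -> layers A = layers A'.

Definition active A B : {set 'I_mu} :=
  [set i in B | (0 <= A i 0) && (0 <= A i 1)]%SET.

(* The active indices, with the total preorder (hence also the ties) of the
   active points by first coordinate, as a set of pairs. *)
Definition staircase A B : {set 'I_mu} * {set 'I_mu * 'I_mu} :=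
  (active A B,
   [set ij in finset.setX (active A B) (active A B) | A ij.1 0 <= A ij.2 0]%SET).

Definition fixed_staircases S : Prop :=
  forall A A', S A -> S A' ->
  forall l, staircase A (layer A l) = staircase A' (layer A' l).

Definition realizes (k : 'I_2) A B (i : 'I_mu) : Prop :=
  i \in B /\ A i k = extent k A B.

(* Ties between realizing points may vary over S, as long as one index keeps
   realizing the extent. *)
Definition fixed_extents S : Prop :=
  forall (k : 'I_2) (l : nat), exists i : 'I_mu,
  forall A, S A -> (l < nlayers A)%N -> realizes k A (layer A l) i.

Lemma nondominated_neq0 A B : B != finset.set0 -> nondominated A B != finset.set0.
Proof.
case/set0Pn => i0 Bi0; apply/set0Pn.
pose f (i : 'I_mu) : R := A i 0 + A i 1.
have [i Bi imax] := @Order.TotalTheory.arg_maxP _ _ _ i0 (mem B) f Bi0.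
exists i; rewrite inE; apply/andP; split; first exact: Bi.
apply/negP => /existsP[j /andP[Bj /andP[/forallP dom /eqP neq]]].
apply: neq; have := imax j Bj; rewrite /f => le_ji.
have := dom 0; have := dom 1; rewrite !mxE => d1 d0.
have e0 : A j 0 = A i 0.
  by apply/le_anti; rewrite d0 andbT -(lerD2r (A i 1)) (le_trans _ le_ji)// lerD2l.
have e1 : A j 1 = A i 1.
  by apply/le_anti; rewrite d1 andbT -(lerD2l (A i 0)) (le_trans _ le_ji)// lerD2r.
apply/rowP => k; rewrite !mxE.
by case: k => -[|[|//]] ?; [move: e0 | move: e1];
  congr (_ = _); congr (A _ _); exact: val_inj.
Qed.

Lemma layers_cover A i : exists2 l, (l < nlayers A)%N & i \in layer A l.
Proof.
suff peelP n B : (#|B| <= n)%N -> i \in B ->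
    exists2 l, (l < size (peel A n B))%N & i \in nth finset.set0 (peel A n B) l.
  by apply: peelP; rewrite ?inE// cardsT card_ord.
elim: n B => [|n IHn] B.
  by rewrite leqn0 cards_eq0 => /eqP ->; rewrite inE.
move=> leB Bi /=; have B0 : B != finset.set0 by apply/set0Pn; exists i.
rewrite (negbTE B0); have [Ni|Ni] := boolP (i \in nondominated A B).
  by exists 0%N.
have [||l ltl il] := IHn (B :\: nondominated A B)%SET.
- have NB : nondominated A B \subset B by apply/fintype.subsetP => j; rewrite inE => /andP[].
  rewrite cardsDS// leq_subLR (leq_trans leB)// -add1n leq_add2r card_gt0.
  exact: nondominated_neq0.
- by rewrite !inE in Ni *; rewrite Ni Bi.
- by exists l.+1.
Qed.

End Surrogate.

(* Main.v *)
(* Two points of a layer never strictly dominate each other, so listing the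
   active points by decreasing first coordinate lists their second coordinates
   in increasing order.  Hence the dominated region of a layer is a disjoint
   union of vertical strips whose areas are bilinear in the coordinates, and on
   a region with fixed combinatorics the order of the strips does not depend on
   the configuration.  There the surrogate coincides with one function on the
   whole space, built from polynomials and exponentials of polynomials. *)
Require Import Defs.
From HB Require Import structures.
From mathcomp Require Import all_boot all_order all_algebra.
From mathcomp Require Import all_classical all_reals all_analysis.

Import Order.TTheory GRing.Theory Num.Theory.
Import numFieldNormedType.Exports.

Local Open Scope ring_scope.

(** * Closure properties of $C^n$ functions *)

Section CkClosure.
Context {R : realType} {V : normedModType R}.
Implicit Types f g : V -> R.

(** The product rule and the chain rule for [expR] leave a factor undifferentiated; this lowers its
    order to that of the induction hypothesis. *)
Lemma Ck_pred n f : Ck n.+1 setT f -> Ck n setT f.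
Proof.
elim: n f => [|n IHn] f /= [df Df].
  by move=> x Tx; exact/differentiable_continuous/df.
by split=> // v; exact/IHn/Df.
Qed.

Lemma Ck_cst n (c : R) : Ck n setT (fun _ : V => c).
Proof.
elim: n c => [|n IHn] c; first by move=> x _; exact: cvg_cst.
split=> [x _|v]; first exact: differentiable_cst.
rewrite (_ : 'D_v _ = fun=> 0); first exact: IHn.
by apply/funext => x; exact: derive_cst.
Qed.

Lemma Ck_linear n (f : {linear V -> R}) : continuous f -> Ck n setT f.
Proof.
move=> cf; case: n => [|n]; first by move=> x _; exact: cf.
have df x : differentiable f x by exact: linear_differentiable.
split=> // v; rewrite (_ : 'D_v f = fun=> f v); first exact: Ck_cst.
by apply/funext => x; rewrite deriveE// diff_lin.
Qed.

Lemma CkD n f g : Ck n setT f -> Ck n setT g -> Ck n setT (fun x => f x + g x).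
Proof.
elim: n f g => [|n IHn] f g.
  by move=> cf cg x Tx; apply: cvgD; [exact: cf|exact: cg].
move=> [df Df] [dg Dg]; split=> [x Tx|v].
  by apply: differentiableD; [exact: df|exact: dg].
rewrite (_ : 'D_v _ = fun x => 'D_v f x + 'D_v g x); first by apply: IHn; [apply: Df|apply: Dg].
by apply/funext => x; apply: deriveD; apply: diff_derivable; [apply: df|apply: dg].
Qed.

Lemma CkM n f g : Ck n setT f -> Ck n setT g -> Ck n setT (fun x => f x * g x).
Proof.
elim: n f g => [|n IHn] f g.
  by move=> cf cg x Tx; apply: cvgM; [exact: cf|exact: cg].
move=> Cf Cg; have [[df Df] [dg Dg]] := (Cf, Cg); split=> [x Tx|v].
  by apply: differentiableM; [exact: df|exact: dg].
rewrite (_ : 'D_v _ = fun x => f x * 'D_v g x + g x * 'D_v f x).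
  by apply: CkD; apply: IHn; [exact: Ck_pred|exact: Dg|exact: Ck_pred|exact: Df].
by apply/funext => x; apply: deriveM; apply: diff_derivable; [apply: df|apply: dg].
Qed.

Lemma Ck_expR n f : Ck n setT f -> Ck n setT (fun x => expR (f x)).
Proof.
elim: n f => [|n IHn] f.
  by move=> cf x Tx; apply: continuous_comp; [exact: cf|exact: continuous_expR].
have dexp y : differentiable (@expR R) y by exact/derivable1_diffP.
move=> Cf; have [df Df] := Cf; split=> [x Tx|v].
  by apply: differentiable_comp => //; exact: df.
rewrite (_ : 'D_v _ = fun x => expR (f x) * 'D_v f x).
  by apply: CkM; [exact/IHn/Ck_pred|exact: Df].
apply/funext => x; have dfx := df x I; rewrite deriveE; last exact: differentiable_comp.
by rewrite diff_comp//= diff1E// derive1E derive_val -deriveE// mulrC.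
Qed.

End CkClosure.

(** * Finite sums and matrix coordinates *)

Section CinftyClosure.
Context {R : realType} {V : normedModType R}.

Lemma Cinfty_sum (I : Type) (r : seq I) (P : pred I) (F : I -> V -> R) :
  (forall i, P i -> Cinfty setT (F i)) ->
  Cinfty setT (fun x => \sum_(i <- r | P i) F i x).
Proof.
move=> CF n; elim: r => [|i r IHr].
  rewrite (_ : (fun _ => _) = fun=> 0); first exact: Ck_cst.
  by apply/funext => x; rewrite big_nil.
rewrite (_ : (fun _ => _) = fun x =>
    if P i then F i x + \sum_(j <- r | P j) F j x else \sum_(j <- r | P j) F j x).
  case: (boolP (P i)) => // Pi; apply: CkD => //; exact: CF.
by apply/funext => x; rewrite big_cons.
Qed.

Lemma Cinfty_coord m k (i : 'I_m) (j : 'I_k) :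
  Cinfty setT (fun A : 'M[R]_(m, k) => A i j).
Proof.
move=> n.
have lin : linear (fun A : 'M[R]_(m, k) => A i j : R^o) by move=> a A B; rewrite !mxE.
pose fM := GRing.isLinear.Build _ _ _ _ _ lin.
pose f : {linear 'M[R]_(m, k) -> R} := HB.pack (fun A : 'M[R]_(m, k) => A i j) fM.
apply: (Ck_linear n f); exact: coord_continuous.
Qed.

Lemma Cinfty_coordB m k (i i' : 'I_m) (j j' : 'I_k) :
  Cinfty setT (fun A : 'M[R]_(m, k) => A i j - A i' j').
Proof.
move=> n; rewrite (_ : (fun _ => _) = fun A : 'M[R]_(m, k) => A i j + (-1) * A i' j').
  apply: CkD; first exact: Cinfty_coord.
  by apply: CkM; [exact: Ck_cst|exact: Cinfty_coord].
by apply/funext => A; rewrite mulN1r.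
Qed.

End CinftyClosure.

(** * Area under a staircase *)

Section StaircaseArea.
Context {R : realType} {I : choiceType} (x y : I -> R).
Local Open Scope classical_set_scope.

(* The list runs down the staircase from right to left; each point adds the
   vertical strip between its abscissa and that of the next point. *)
Fixpoint staircase_area (s : seq I) : R :=
  if s is i :: s' then
    (x i - head 0 (map x s')) * y i + staircase_area s'
  else 0.

Lemma staircase_measure (s : seq I) :
  all (fun i => (0 <= x i) && (0 <= y i)) s ->
  pairwise (fun i j => (x j <= x i) && (y i <= y j)) s ->
  (lebesgue_measure \x lebesgue_measure)%E
    (\big[setU/set0]_(i <- s) (`[0, x i] `*` `[0, y i])) = (staircase_area s)%:E.
Proof.
(* The boolean covers both closed and left-open intervals; [c = d] is a separate case because the
   measure formula tests [c < d]. *)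
have itvE (b : bool) (c d : R) : c <= d ->
    lebesgue_measure [set` Interval (BSide b c) (BRight d)] = (d - c)%:E.
  move=> cd; rewrite lebesgue_measure_itv/= lte_fin EFinB; case: ltgtP cd => // -> _.
  by rewrite subee.
elim: s => [|i s IHs]; first by rewrite big_nil measure0.
rewrite big_cons /= => /andP[/andP[xi yi] s_ge0] /andP[lt_i ps].
(* The last point has no successor: the default [0] of [head] makes its strip the whole box, closed
   on the left. *)
case: s => [|j s] in IHs s_ge0 lt_i ps *.
  rewrite big_nil setU0 product_measure1E//= !itvE// -EFinM !subr0 addr0//.
move: (lt_i) => /= /andP[/andP[xji yij] lt_is].
set D := \big[_/_]_(_ <- _) _.
(* The part of the new box to the left of [x j] lies in the box of [j]. *)
have -> : `[0, x i] `*` `[0, y i] `|` D = (`]x j, x i] `*` `[0, y i]) `|` D.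
  apply/seteqP; split=> -[u v]/=; last first.
    move=> [[]|]; last by right.
    rewrite /= !in_itv/= => /andP[xju uxi] yv; left; split=> //.
    rewrite uxi andbT (le_trans _ (ltW xju))//.
    by move: s_ge0 => /= /andP[/andP[]].
  move=> [[]|]; last by right.
  rewrite /= !in_itv/= => /andP[u0 uxi] /andP[v0 vy].
  have [ux|xu] := leP u (x j).
    right; rewrite /D big_cons; left; split=> /=; rewrite in_itv/= ?u0 ?v0//=.
    exact: le_trans yij.
  by left; split; apply/andP; split.
have mD : measurable D by apply: bigsetU_measurable => k _; exact: measurableX.
rewrite measureU//=.
- by rewrite product_measure1E//= !itvE// subr0 -EFinM IHs.
- exact: measurableX.
(* Disjointness: all remaining abscissas are at most [x j], where the strip is open. *)
- rewrite /D -bigcup_seq; apply/seteqP; split=> // -[u v] [[/=]].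
  rewrite in_itv/= => /andP[xju _] _ [k /= ks] [/=].
  rewrite in_itv/= => /andP[_ uxk] _.
  move: ps => /=/andP[/allP lt_j _].
  suff : x k <= x j by move=> /(le_trans uxk)/(lt_le_trans xju); rewrite ltxx.
  by move: ks; rewrite in_cons => /orP[/eqP -> //|/lt_j/andP[]].
Qed.

End StaircaseArea.

(** * Layers, their hypervolume, and the surrogate *)

Section Layers.
Context {R : realType} {mu : nat}.
Implicit Types A : 'M[R]_(mu, 2).

(** A layer is the nondominated part of the indices left at its stage, and both indices are among
    these. The induction must let that set vary. *)
Lemma layer_antichain A l i j : i \in layer A l -> j \in layer A l ->
  ~~ strictly_dominates (row j A) (row i A).
Proof.
suff peel_antichain n B : i \in nth finset.set0 (peel A n B) l ->
    j \in nth finset.set0 (peel A n B) l -> ~~ strictly_dominates (row j A) (row i A).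
  exact: peel_antichain.
elim: n l B => [|n IHn] l B /=; first by rewrite nth_nil inE.
case: ifPn => _; first by rewrite nth_nil inE.
case: l => [|l] /=; last exact: IHn.
rewrite inE => /andP[_ /existsPn/(_ j)]; rewrite negb_and => + /setIdP[jB _].
by rewrite jB.
Qed.

(** Otherwise [i] would strictly dominate [j]. Used in both directions, this also makes points with
    equal abscissas coincide. *)
Lemma layer_antitone A l i j : i \in layer A l -> j \in layer A l ->
  A j 0 <= A i 0 -> A i 1 <= A j 1.
Proof.
move=> il jl le0; rewrite leNgt; apply/negP => lt1.
apply/negP: (layer_antichain A l j i jl il); rewrite negbK.
apply/andP; split; last first.
  by apply: contraTneq lt1 => /rowP/(_ 1); rewrite !mxE => ->; rewrite ltxx.
apply/forallP => k; rewrite !mxE; case: k => -[|[|//]] ?.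
  by rewrite [Ordinal _](_ : _ = 0)//; exact: val_inj.
by rewrite [Ordinal _](_ : _ = 1) ?ltW//; exact: val_inj.
Qed.

(* Ties are broken arbitrarily: nondomination makes tied points coincide. *)
Definition staircase_order A (B : {set 'I_mu}) : seq 'I_mu :=
  sort (fun i j => A j 0 <= A i 0) (enum (active A B)).

(** The list is sorted at [A0] only; equality of the staircases carries its members and its order
    over to [A], so one formula serves the whole region. *)
Lemma HV_staircase_area A0 A l :
  staircase A (layer A l) = staircase A0 (layer A0 l) ->
  HV A (layer A l) =
  staircase_area (A^~ 0) (A^~ 1) (staircase_order A0 (layer A0 l)).
Proof.
set s := staircase_order _ _ => -[actE ordE].
have sE i : (i \in s) = (i \in active A (layer A l)).
  by rewrite mem_sort mem_enum actE.
have s_layer i : i \in s -> i \in layer A l by rewrite sE => /setIdP[].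
have s_ge0 i : i \in s -> (0 <= A i 0) && (0 <= A i 1) by rewrite sE => /setIdP[].
have leE i j : i \in s -> j \in s -> (A0 i 0 <= A0 j 0) = (A i 0 <= A j 0).
  move=> si sj; have := congr1 (fun X : {set _} => (i, j) \in X) ordE.
  by rewrite 2!finset.in_set /= -!sE si sj 2!finset.in_set /= -!actE -!sE si sj => /esym.
have ps : pairwise (fun i j => (A j 0 <= A i 0) && (A i 1 <= A j 1)) s.
  have : pairwise (fun i j => A0 j 0 <= A0 i 0) s.
    rewrite -sorted_pairwise; last by move=> a b c /[swap]; exact: le_trans.
    by apply: sort_sorted => i j; exact: le_total.
  apply: (@sub_in_pairwise _ (mem s)); last exact/allP.
  move=> i j si sj; rewrite leE// => ji; rewrite ji/=.
  exact: layer_antitone (s_layer _ si) (s_layer _ sj) ji.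
rewrite /HV (_ : dominated_region _ _ =
    (\big[setU/set0]_(i <- s) (`[0%R, A i 0] `*` `[0%R, A i 1]))%classic).
  by rewrite staircase_measure//; exact/allP.
rewrite -bigcup_seq; apply/seteqP; split=> -[u v] [i /=].
  (* A nonempty box has nonnegative sides, so its index is active. *)
  move=> il; rewrite !in_itv/= => -[/andP[u0 ui] /andP[v0 vi]].
  exists i; last by split; apply/andP.
  by rewrite /= sE inE il (le_trans u0)//= (le_trans v0).
by move=> /s_layer il uv; exists i.
Qed.

Lemma Cinfty_staircase_area (s : seq 'I_mu) :
  Cinfty setT (fun A : 'M[R]_(mu, 2) => staircase_area (A^~ 0) (A^~ 1) s).
Proof.
move=> n; elim: s => [|i s IHs]; first exact: Ck_cst.
apply: CkD => //; apply: CkM; last exact: Cinfty_coord.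
rewrite -[fun _ => _]/(fun A : 'M[R]_(mu, 2) => A i 0 - head 0 [seq A j 0 | j <- s]).
case: s {IHs} => [|j s]; rewrite /=.
  by apply: CkD; [exact: Cinfty_coord|exact: Ck_cst].
exact: Cinfty_coordB.
Qed.

(** The norm is not smooth at zero, but it enters only through its square, a polynomial in the
    coordinates. *)
Lemma Cinfty_repulsion (sigma : R) : Cinfty setT (@repulsion R mu sigma).
Proof.
apply: Cinfty_sum => i _; apply: Cinfty_sum => j _ n; apply: Ck_expR.
rewrite (_ : (fun _ => _) = fun A : 'M[R]_(mu, 2) =>
    (\sum_k (A i k - A j k) * (A i k - A j k)) * (- (sigma ^+ 2)^-1)).
  apply: CkM; last exact: Ck_cst.
  by apply: Cinfty_sum => k _ m; apply: CkM; exact: Cinfty_coordB.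
apply/funext => A; rewrite sqr_sqrtr; last by apply: sumr_ge0 => k _; exact: sqr_ge0.
by rewrite mulrN; congr (- (_ / _)); apply: eq_bigr => k _; rewrite !mxE expr2.
Qed.

(** Common to both indicators: fixed membership makes the number of layers constant, so a smooth
    formula per layer yields one global extension, taken with [U = setT]. *)
Lemma smooth_surrogate (I : 'M[R]_(mu, 2) -> {set 'I_mu} -> R)
    (F : nat -> 'M[R]_(mu, 2) -> R) (eps tau sigma : R) (S : set 'M[R]_(mu, 2)) :
  fixed_membership S -> (forall l, Cinfty setT (F l)) ->
  (forall A l, S A -> (l < nlayers A)%N -> I A (layer A l) = F l A) ->
  smooth_on S (surrogate I eps tau sigma).
Proof.
move=> fS CF IF A0 SA0; exists setT, (fun A =>
  \sum_(0 <= l < nlayers A0) eps ^+ l * F l A + (- tau) * repulsion sigma A).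
split => //; first exact: openT.
  move=> n; apply: CkD; last by apply: CkM; [exact: Ck_cst|exact: Cinfty_repulsion].
  by apply: Cinfty_sum => l _ m; apply: CkM; [exact: Ck_cst|exact: CF].
move=> A SA _; rewrite /surrogate mulNr; congr (_ - _).
have -> : nlayers A0 = nlayers A by rewrite /nlayers (fS A0 A).
by apply: eq_big_nat => l /andP[_ lA]; rewrite IF.
Qed.

End Layers.

Theorem proposition2 (R : realType) (mu : nat) (eps tau sigma : R)
    (mu_ge1 : (1 <= mu)%N) (eps_gt0 : 0 < eps) (eps_lt1 : eps < 1)
    (tau_ge0 : 0 <= tau) (sigma_gt0 : 0 < sigma) :
  (forall S : set 'M[R]_(mu, 2),
     fixed_membership S -> fixed_staircases S ->
     smooth_on S (surrogate (@HV R mu) eps tau sigma)) /\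
  (forall S : set 'M[R]_(mu, 2),
     fixed_membership S -> fixed_staircases S -> fixed_extents S ->
     smooth_on S (surrogate (@MagD R mu) eps tau sigma)).
Proof.
(* The base point [A0] supplies the reference order for all of [S]. *)
split=> S fS sS => [|xS] A0 SA0; have HVE A l : S A -> HV A (layer A l) =
    staircase_area (A^~ 0) (A^~ 1) (staircase_order A0 (layer A0 l)) by
  move=> SA; apply: HV_staircase_area; exact: sS.
  apply: (smooth_surrogate _ (fun l A =>
      staircase_area (A^~ 0) (A^~ 1) (staircase_order A0 (layer A0 l)))) => // [l|A l SA _].
    exact: Cinfty_staircase_area.
  exact: HVE.
(* The chosen indices depend on the layer but not on [A], so each extent is a coordinate function on
   [S]. *)
have [i0 i0P] := choice (xS 0); have [i1 i1P] := choice (xS 1).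
apply: (smooth_surrogate _ (fun l A => 1 + (A (i0 l) 0 + A (i1 l) 1) / 2 +
    staircase_area (A^~ 0) (A^~ 1) (staircase_order A0 (layer A0 l)) / 4))
    => // [l n|A l SA lA].
  apply: CkD; [apply: CkD; [exact: Ck_cst|apply: CkM; [|exact: Ck_cst]]
              |apply: CkM; [exact: Cinfty_staircase_area|exact: Ck_cst]].
  by apply: CkD; exact: Cinfty_coord.
have [_ e0] := i0P l A SA lA; have [_ e1] := i1P l A SA lA.
by rewrite /MagD -e0 -e1 HVE.
Qed.
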